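(* Let $\lambda=(r,h):S^1\to\mathbb{R}^2$ be a smooth embedding such that $r(s)>0$ for all $s\in S^1$, and let $\mathcal{K}=\lambda(S^1)$. Then for any compact set $B\subseteq\mathbb{R}^2$ containing $\mathcal{K}$ in its interior, there is an admissible perturbation $\alpha$ for $\mathcal{K}$ supported in $B$ such that the surface of revolution $\mathcal{F}(\bar\alpha(1)\circ\lambda)$ admits a nontrivial infinitesimal deformation.
   Context: $S^1$ is identified with $\mathbb{R}/2\pi\mathbb{Z}$. For a smooth map $\mu=(r,h):S^1\to\mathbb{R}^2$ with $r>0$, the surface of revolution $\mathcal{F}(\mu)$ is the map $F:S^1\times\mathbb{R}\to\mathbb{R}^3$, $F(s,t)=r(s)(\cos t,\sin t,0)+h(s)(0,0,1)$. An infinitesimal deformation of $F$ is a smooth map $Z:S^1\times\mathbb{R}\to\mathbb{R}^3$, $2\pi$-periodic in $t$, such that $\mathrm{d}Z(X)\bullet\mathrm{d}F(X)=0$ for every tangent vector $X$, equivalently $\partial_sZ\bullet\partial_sF=0$, $\partial_tZ\bullet\partial_tF=0$, $\partial_tZ\bullet\partial_sF+\partial_sZ\bullet\partial_tF=0$ ($\bullet$ the dot product). It is trivial if it is of the form $Z(s,t)=\mu\times F(s,t)+\omega$ for constants $\mu,\omega\in\mathbb{R}^3$ (those arising from bendings by rigid motions), and nontrivial otherwise. An isotopy of $\mathbb{R}^2$ is a $C^3$ map $\alpha:[0,1]\times\mathbb{R}^2\to\mathbb{R}^2$ such that each $\bar\alpha(t):p\mapsto\alpha(t,p)$ is a $C^3$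 homeomorphism and $\bar\alpha(0)=\mathrm{Id}$. For $\mathcal{K}\subseteq\{(x,z):x>0\}$, an isotopy $\alpha$ is an admissible perturbation for $\mathcal{K}$ if $\bar\alpha(t)(\mathcal{K})\subseteq\{(x,z):x>0\}$ for all $t\in[0,1]$. The support of a map $G:\mathbb{R}^2\to\mathbb{R}^2$ is the closure of $\{p:G(p)\neq p\}$; the support of the isotopy $\alpha$ is the closure of the union over $t\in[0,1]$ of the supports of $\bar\alpha(t)$. *)

(* Defs.v *)
From mathcomp Require Import all_boot all_algebra all_classical all_reals all_analysis.
Import GRing.Theory Num.Theory numFieldNormedType.Exports.
Set Implicit Arguments. Unset Strict Implicit. Unset Printing Implicit Defensive.
Local Open Scope ring_scope.
Local Open Scope classical_set_scope.

(* C^k maps between (finite dimensional) normed spaces, via iterated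
   directional derivatives: C^0 = continuous; C^(k+1) = continuous, all
   directional derivatives exist everywhere and each 'D_v f is C^k. *)
Fixpoint Ck {R : realType} {V W : normedModType R} (k : nat) (f : V -> W)
  : Prop :=
  match k with
  | 0 => continuous f
  | k'.+1 => continuous f /\ (forall x v, derivable f x v) /\
             (forall v, Ck k' ('D_v f))
  end.

Definition smooth {R : realType} {V W : normedModType R} (f : V -> W) : Prop :=
  forall k, Ck k f.

(* S^1 = R / 2piZ : maps out of S^1 are 2pi-periodic maps out of R. *)
Definition periodic2pi {R : realType} {T : Type} (f : R -> T) : Prop :=
  forall s, f (s + 2 * pi) = f s.

Definition smooth_embedding_S1 {R : realType} (lam : R -> R * R) : Prop :=
  smooth lam /\ periodic2pi lam /\
  (forall s s', lam s = lam s' -> exists k : int, s' = s + k%:~R * (2 * pi)) /\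
  (forall s, 'D_1 lam s <> 0).

Definition dot3 {R : realType} (u v : R * R * R) : R :=
  u.1.1 * v.1.1 + u.1.2 * v.1.2 + u.2 * v.2.

Definition cross3 {R : realType} (u v : R * R * R) : R * R * R :=
  (u.1.2 * v.2 - u.2 * v.1.2, u.2 * v.1.1 - u.1.1 * v.2,
   u.1.1 * v.1.2 - u.1.2 * v.1.1).

Definition surf_rev {R : realType} (mu : R -> R * R) : R * R -> R * R * R :=
  fun p => ((mu p.1).1 * cos p.2, (mu p.1).1 * sin p.2, (mu p.1).2).

Definition inf_deformation {R : realType} (F Z : R * R -> R * R * R) : Prop :=
  smooth Z /\
  (forall s t, Z (s + 2 * pi, t) = Z (s, t)) /\
  (forall s t, Z (s, t + 2 * pi) = Z (s, t)) /\
  (forall (p X : R * R), dot3 ('D_X Z p) ('D_X F p) = 0).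

Definition trivial_deformation {R : realType} (F Z : R * R -> R * R * R)
  : Prop :=
  exists mu omega : R * R * R, forall p, Z p = cross3 mu (F p) + omega.

Definition homeomorphism {R : realType} (f : R * R -> R * R) : Prop :=
  continuous f /\
  exists g : R * R -> R * R, continuous g /\ cancel f g /\ cancel g f.

(* isotopy: alpha given on R x R^2 (C^3 there); its restriction to
   [0,1] x R^2 is the isotopy. *)
Definition isotopy {R : realType} (al : R -> R * R -> R * R) : Prop :=
  Ck 3 (fun q : R * (R * R) => al q.1 q.2) /\
  (forall t, 0 <= t <= 1 -> homeomorphism (al t)) /\
  (forall p, al 0 p = p).

Definition admissible {R : realType} (K : set (R * R))
  (al : R -> R * R -> R * R) : Prop :=
  forall t, 0 <= t <= 1 -> forall p, K p -> 0 < (al t p).1.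

Definition isotopy_support {R : realType} (al : R -> R * R -> R * R)
  : set (R * R) :=
  closure [set p | exists t, 0 <= t <= 1 /\ al t p <> p].

(* Main.v *)
Require Import Defs.
From mathcomp Require Import all_boot all_order all_algebra all_classical all_reals all_analysis.
From mathcomp Require Import ring lra.
Import Order.TTheory GRing.Theory Num.Theory numFieldNormedType.Exports.
Set Implicit Arguments. Unset Strict Implicit. Unset Printing Implicit Defensive.
Local Open Scope ring_scope.
Local Open Scope classical_set_scope.

(* If the profile curve is horizontal over a parameter interval, the surface of
   revolution contains a planar annulus, and a vertical field [(0, 0, phi s)]
   with [phi] a bump function supported there deforms it infinitesimally: it
   moves only planar points, in the normal direction.  Since the support
   condition on the perturbation does not control derivatives, a piece of the
   curve can always be made horizontal: by Rolle applied to [h] there is [s0]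
   with [r'(s0) <> 0], so that the curve is near [lam s0] a graph [z = g x], and
   the shear [(x, z) |-> (x, z + t G(x) b(z))], where [G] is [g x0 - g] cut off
   near [x0] and [b] is a bump at [g x0], flattens that graph at [t = 1].  If
   [G] is small compared with the derivative of [b], each vertical line is
   mapped by a contractive perturbation of the identity. *)

(** * Calculus of C^k maps through directional derivatives *)

Section CkTheory.
Variable R : realType.
Implicit Types U V W : normedModType R.

Lemma derivative_is_derive V W (f : V -> W) (df : V -> V -> W) :
  (forall x v, is_derive x v f (df v x)) -> forall v, 'D_v f = df v.
Proof. by move=> fd v; apply/funext => x; rewrite (@derive_val _ _ _ x v). Qed.

(** Inductions on [k] can thus use an explicit formula for the derivative in place of ['D_v f]. *)
Lemma CkSI V W k (f : V -> W) (df : V -> V -> W) : continuous f ->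
  (forall x v, is_derive x v f (df v x)) -> (forall v, Ck k (df v)) ->
  Ck k.+1 f.
Proof.
move=> fc fd dfk; split=> //; split=> [x v|v]; first by have [] := fd x v.
by rewrite (derivative_is_derive fd).
Qed.

Lemma Ck_continuous V W k (f : V -> W) : Ck k f -> continuous f.
Proof. by case: k => [//|k []]. Qed.

Lemma Ck_is_derive V W k (f : V -> W) x v : Ck k.+1 f ->
  is_derive x v f ('D_v f x).
Proof. by case=> _ [+ _] => /(_ x v)/derivableP. Qed.

Lemma Ck_derive V W k (f : V -> W) v : Ck k.+1 f -> Ck k ('D_v f).
Proof. by case=> _ [_ +]; apply. Qed.

Lemma CkW V W k (f : V -> W) : Ck k.+1 f -> Ck k f.
Proof.
elim: k f => [|k IH] f; first exact: Ck_continuous.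
move=> fk; apply: (@CkSI _ _ _ _ (fun v => 'D_v f)).
- exact: Ck_continuous fk.
- by move=> x v; apply: Ck_is_derive fk.
- by move=> v; apply/IH/Ck_derive.
Qed.

Lemma is_derive_linear V W (L : {linear V -> W}) x v : continuous L ->
  is_derive x v L (L v).
Proof.
move=> Lc; have Ld := @linear_differentiable _ _ _ L x Lc.
by split; [exact: diff_derivable|rewrite deriveE// diff_lin].
Qed.

Lemma is_derive_comp_linear U V W (L : {linear V -> W}) (f : U -> V) x v df :
  continuous L -> is_derive x v f df -> is_derive x v (L \o f) (L df).
Proof.
move=> Lc [fd fE].
have LfE : (fun h : R => h^-1 *: ((L \o f) (h *: v + x) - (L \o f) x)) =
   L \o (fun h : R => h^-1 *: (f (h *: v + x) - f x)).
  by apply/funext => h; rewrite /= -linearB -linearZZ.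
have : (fun h : R => h^-1 *: ((L \o f) (h *: v + x) - (L \o f) x)) @ 0^' -->
  L df.
  have fd' : (fun h : R => h^-1 *: (f (h *: v + x) - f x)) @ 0^' --> df.
    by rewrite -fE.
  by rewrite LfE; apply: cvg_comp fd' (Lc df).
move=> cv; split; first by apply/cvg_ex; exists (L df).
exact/cvg_lim.
Qed.

Lemma is_derive_pair U V W (f : U -> V) (g : U -> W) x v df dg :
  is_derive x v f df -> is_derive x v g dg ->
  is_derive x v (fun y => (f y, g y)) (df, dg).
Proof.
move=> [fd <-] [gd <-].
have : (fun h : R => h^-1 *: ((f (h *: v + x), g (h *: v + x)) - (f x, g x)))
   @ 0^' --> ('D_v f x, 'D_v g x).
  exact: (cvg_pair fd gd).
move=> cv; split; first by apply/cvg_ex; exists ('D_v f x, 'D_v g x).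
exact/cvg_lim.
Qed.

(** Restriction to a line gives access to the chain rule in one real variable. *)
Lemma is_derive1P V W (f : V -> W) x v df :
  is_derive x v f df <-> is_derive (0 : R) 1 (fun h : R => f (h *: v + x)) df.
Proof.
have E : 'D_v f x = 'D_1 (fun h : R => f (h *: v + x)) 0.
  rewrite /derive; set g1 := fun h => h^-1 *: _; set g2 := fun h => h^-1 *: _.
  suff -> : g1 = g2 by [].
  by rewrite funeqE /g1 /g2 => h /=; rewrite addr0 scale0r add0r [_%:A]mulr1.
split=> -[d e].
- by split; [exact: (derivable1P f x v).1 d|rewrite -E].
- by split; [exact: (derivable1P f x v).2 d|rewrite E].
Qed.

Lemma is_derive_comp V (f : R -> R) (g : V -> R) x v a b :
  is_derive (g x) 1 f a -> is_derive x v g b -> is_derive x v (f \o g) (b * a).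
Proof.
move=> fd /is_derive1P gd; rewrite mulrC; apply/is_derive1P.
apply: (@is_derive1_comp R f (fun h : R => g (h *: v + x))) => //.
by rewrite scale0r add0r.
Qed.

Lemma Ck_cst V W k (c : W) : Ck k (cst c : V -> W).
Proof.
elim: k c => [|k IH] c; first exact: cst_continuous.
by apply: (@CkSI _ _ _ _ (fun _ => cst 0)) => //; apply: cst_continuous.
Qed.

Lemma Ck_linear V W k (L : {linear V -> W}) : continuous L -> Ck k L.
Proof.
case: k => // k Lc; apply: (@CkSI _ _ _ _ (fun v => cst (L v))) => //.
- by move=> x v; exact: is_derive_linear.
- by move=> v; exact: Ck_cst.
Qed.

Lemma Ck_comp_linear U V W k (L : {linear V -> W}) (f : U -> V) :
  continuous L -> Ck k f -> Ck k (L \o f).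
Proof.
move=> Lc; elim: k f => [|k IH] f fk.
  by move=> x; apply: continuous_comp; [exact: fk|exact: Lc].
apply: (@CkSI _ _ _ _ (fun v => L \o 'D_v f)).
- move=> x; apply: continuous_comp; [exact: (Ck_continuous fk)|exact: Lc].
- move=> x v; apply: is_derive_comp_linear => //; exact: Ck_is_derive fk.
- by move=> v; apply/IH/Ck_derive.
Qed.

Lemma Ck_pair U V W k (f : U -> V) (g : U -> W) : Ck k f -> Ck k g ->
  Ck k (fun x => (f x, g x)).
Proof.
elim: k f g => [|k IH] f g fk gk.
  by move=> x; apply: cvg_pair; [exact: fk|exact: gk].
apply: (@CkSI _ _ _ _ (fun v x => ('D_v f x, 'D_v g x))).
- move=> x.
  by apply: cvg_pair; [exact: (Ck_continuous fk)|exact: (Ck_continuous gk)].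
- move=> x v.
  by apply: is_derive_pair; [exact: Ck_is_derive fk|exact: Ck_is_derive gk].
- by move=> v; apply: IH; apply: Ck_derive.
Qed.

Lemma Ck_add V W k (f g : V -> W) : Ck k f -> Ck k g -> Ck k (f + g).
Proof.
elim: k f g => [|k IH] f g fk gk.
  by move=> x; apply: cvgD; [exact: fk|exact: gk].
apply: (@CkSI _ _ _ _ (fun v => 'D_v f + 'D_v g)).
- move=> x; apply: cvgD; [exact: (Ck_continuous fk)|exact: (Ck_continuous gk)].
- move=> x v.
  by apply: is_deriveD; [apply: Ck_is_derive fk|apply: Ck_is_derive gk].
- by move=> v; apply: IH; apply: Ck_derive.
Qed.

Lemma Ck_mul V k (f g : V -> R) : Ck k f -> Ck k g -> Ck k (f * g).
Proof.
elim: k f g => [|k IH] f g fk gk.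
  by move=> x; apply: cvgM; [exact: fk|exact: gk].
apply: (@CkSI _ _ _ _ (fun v => f * 'D_v g + g * 'D_v f)).
- move=> x.
  by apply: cvgM; [exact: (Ck_continuous fk)|exact: (Ck_continuous gk)].
- move=> x v.
  by apply: is_deriveM; [exact: Ck_is_derive fk|exact: Ck_is_derive gk].
- move=> v; apply: Ck_add; apply: IH; by [exact: CkW|exact: Ck_derive].
Qed.

Lemma Ck_opp V k (f : V -> R) : Ck k f -> Ck k (- f).
Proof.
move=> fk; have -> : - f = cst (-1) * f.
  by apply/funext => x; rewrite /= -[RHS]/(-1 * f x) mulN1r.
exact: Ck_mul (Ck_cst _ _ _) fk.
Qed.

Lemma Ck_sub V k (f g : V -> R) : Ck k f -> Ck k g -> Ck k (f - g).
Proof. by move=> fk gk; apply: Ck_add => //; apply: Ck_opp. Qed.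

Lemma Ck_comp V k (f : R -> R) (g : V -> R) : Ck k f -> Ck k g -> Ck k (f \o g).
Proof.
elim: k f g => [|k IH] f g fk gk.
  by move=> x; apply: continuous_comp; [exact: gk|exact: fk].
apply: (@CkSI _ _ _ _ (fun v => 'D_v g * ('D_1 f \o g))).
- move=> x; apply: continuous_comp; first exact: (Ck_continuous gk).
  exact: (Ck_continuous fk).
- move=> x v.
  by apply: is_derive_comp; [exact: Ck_is_derive fk|exact: Ck_is_derive gk].
- move=> v; apply: Ck_mul; first exact: Ck_derive.
  by apply: IH; [exact: Ck_derive|exact: CkW].
Qed.

(** The derivative [- f^-2 * 'D_v f] involves the inverse only at the lower order supplied by
    induction. *)
Lemma Ck_inv V k (f : V -> R) : (forall x, f x != 0) -> Ck k f ->
  Ck k (fun x => (f x)^-1).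
Proof.
move=> f0; elim: k => [|k IH] fk.
  by move=> x; apply: cvgV => //; exact: fk.
have fik := IH (CkW fk).
pose fi x := (f x)^-1.
apply: (@CkSI _ _ _ _ (fun v => - (fi * fi) * 'D_v f)).
- by move=> x; apply: cvgV => //; exact: (Ck_continuous fk).
- move=> x v; have fd := Ck_is_derive x v fk; split; first by apply: derivableV.
  by rewrite deriveV// expr2 invfM.
- move=> v; apply: Ck_mul; last exact: Ck_derive.
  by apply/Ck_opp/Ck_mul.
Qed.

Lemma Ck_id V k : Ck k (id : V -> V).
Proof. by apply: (@Ck_linear _ _ _ idfun) => x. Qed.

Lemma Ck_fst U V W k (f : U -> V * W) : Ck k f -> Ck k (fun x => (f x).1).
Proof. by apply: (@Ck_comp_linear _ _ _ _ fst) => x; exact: cvg_fst. Qed.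

Lemma Ck_snd U V W k (f : U -> V * W) : Ck k f -> Ck k (fun x => (f x).2).
Proof. by apply: (@Ck_comp_linear _ _ _ _ snd) => x; exact: cvg_snd. Qed.

(** On the real line the direction [v] only rescales the derivative, so direction 1 decides. *)
Lemma derive1_Ck k (f df : R -> R) : (forall x : R, is_derive x 1 f (df x)) ->
  Ck k df -> Ck k.+1 f.
Proof.
move=> fd dfk; apply: (@CkSI R R k f (fun v : R => cst v * df)).
- move=> x; apply/differentiable_continuous/derivable1_diffP.
  by have [] := fd x.
- move=> x v.
  have := @is_derive_comp R f id x v (df x) v (fd x) (is_derive_id _ _).
  by [].
- by move=> v; apply: Ck_mul => //; exact: Ck_cst.
Qed.

End CkTheory.

(** * The flat function exp(-1/x) and smooth cutoffs *)

Section Bump.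
Variable R : realType.

(* The powers of [1/x] make the family closed under differentiation. *)
Definition rexp (n : nat) (x : R) : R :=
  if 0 < x then x^-1 ^+ n * expR (- x^-1) else 0.

Lemma rexp_le0 n x : x <= 0 -> rexp n x = 0.
Proof. by rewrite /rexp leNgt => /negbTE ->. Qed.

Lemma rexp_ge0 n x : 0 <= rexp n x.
Proof.
rewrite /rexp; case: ltP => // x0.
by rewrite mulr_ge0 ?exprn_ge0 ?expR_ge0// invr_ge0 ltW.
Qed.

(** For [x > 0] the exponential series at [1/x] contains the term [x^-(n+2) / (n+2)!], hence
    [exp(-1/x) <= (n+2)! x^(n+2)]. The factor [x^2] left over yields differentiability at 0. *)
Lemma rexp_le_sqr n x : rexp n x <= n.+2`!%:R * x ^+ 2.
Proof.
have f0 : 0 < n.+2`!%:R :> R by rewrite ltr0n fact_gt0.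
rewrite /rexp; case: ltP => x0; last by rewrite mulr_ge0 ?sqr_ge0// ltW.
have y0 : 0 < x^-1 by rewrite invr_gt0.
have := expR_ge1Dxn n.+1 (ltW y0) => h.
rewrite expRN -ler_pdivlMr ?invr_gt0 ?expR_gt0// invrK.
apply: (@le_trans _ _ (n.+2`!%:R * x ^+ 2 * (x^-1 ^+ n.+2 / n.+2`!%:R)));
  last first.
  rewrite ler_wpM2l//; first by rewrite mulr_ge0 ?sqr_ge0// ltW.
  by apply: le_trans h; rewrite lerDr.
rewrite le_eqVlt; apply/orP; left; apply/eqP.
rewrite !exprSr -!mulrA; field.
by rewrite !gt_eqF.
Qed.

(** The bound forces [f 0 = 0], and the difference quotient at 0 is at most [|C| |h|]. *)
Lemma is_derive_sqr_bounded (f : R -> R) (C : R) :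
  (forall x, `|f x| <= C * x ^+ 2) -> is_derive (0 : R) 1 f 0.
Proof.
move=> fC.
have f0 : f 0 = 0.
  by apply/eqP; rewrite -normr_le0; have := fC 0; rewrite expr0n mulr0.
have cv : (fun h : R => h^-1 *: (f (h *: 1 + 0) - f 0)) @ 0^' --> (0 : R).
  apply/cvgr0Pnorm_lt => e e0.
  have C1 : 0 < `|C| + 1 by rewrite ltr_wpDl.
  near=> h.
  have h0 : h != 0 by near: h; exact: nbhs_dnbhs_neq.
  rewrite f0 subr0 addr0 [_%:A]mulr1 normrM normfV.
  rewrite -ltr_pdivlMl ?invr_gt0 ?normr_gt0// invrK.
  apply: le_lt_trans (fC h) _.
  rewrite -real_normK ?num_real// expr2 mulrA mulrC ltr_pM2l ?normr_gt0//.
  apply: (@le_lt_trans _ _ ((`|C| + 1) * `|h|)).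
    by rewrite ler_wpM2r// ler_wpDr// ler_norm.
  rewrite mulrC -ltr_pdivlMr//.
  near: h; apply: dnbhs0_lt; exact: divr_gt0.
split; first by apply/cvg_ex; exists 0.
exact/cvg_lim.
Unshelve. all: by end_near. Qed.

(** The two sides of 0 are direct computations; at 0 they are glued by the quadratic bound. *)
Lemma is_derive_rexp n (x : R) :
  is_derive x 1 (rexp n) (rexp n.+2 x - n%:R * rexp n.+1 x).
Proof.
have [x0|x0|->] := ltgtP x 0.
- rewrite !rexp_le0 ?(ltW x0)// mulr0 subr0.
  apply: (@near_eq_is_derive _ _ _ (cst 0 : R -> R)).
  near=> y; rewrite rexp_le0//; apply: ltW; near: y; exact: lt_nbhsl.
- apply: (@near_eq_is_derive _ _ _ (fun y : R => y^-1 ^+ n * expR (- y^-1))).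
    near=> y; rewrite /rexp ifT//; near: y; exact: lt_nbhsr.
  have iV : is_derive x 1 (fun y : R => y^-1) (- x ^- 2).
    split; first by apply: derivableV => //; rewrite gt_eqF.
    by rewrite deriveV ?gt_eqF// derive_id [_ *: _]mulr1.
  have iX := is_deriveX n iV.
  have iE : is_derive x 1 (fun y : R => expR (- y^-1)) (expR (- x^-1) * x ^- 2).
    apply: (@is_derive1_comp R expR (fun y : R => - y^-1)).
    rewrite -[x ^- 2]opprK; exact: is_deriveN.
  have := is_deriveM iX iE.
  have -> : (fun y : R => y^-1) ^+ n * (fun y => expR (- y^-1)) =
      (fun y => y^-1 ^+ n * expR (- y^-1)).
    by apply/funext => y; rewrite exprfctE.
  move=> H; apply: (is_derive_eq H).
  rewrite /rexp x0 exprfctE /GRing.scale /=.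
  case: n {iX H} => [|n]; rewrite /= !exprS ?expr0; field;
    by rewrite gt_eqF.
- rewrite !rexp_le0// mulr0 subr0.
  apply: (@is_derive_sqr_bounded _ n.+2`!%:R) => y.
  by rewrite ger0_norm ?rexp_ge0// rexp_le_sqr.
Unshelve. all: by end_near. Qed.

Lemma smooth_rexp n : smooth (rexp n).
Proof.
move=> k; elim: k n => [|k IH] n.
  move=> x; apply/differentiable_continuous/derivable1_diffP.
  by have [] := is_derive_rexp n x.
apply: (derive1_Ck (is_derive_rexp n)).
by apply: Ck_sub; first exact: IH; apply: Ck_mul => //; exact: Ck_cst.
Qed.

Lemma rexp0_gt0 x : 0 < x -> 0 < rexp 0 x.
Proof. by move=> x0; rewrite /rexp x0 expr0 mul1r expR_gt0. Qed.

Lemma rexp0_nondecreasing : {homo rexp 0 : x y / x <= y}.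
Proof.
move=> x y xy; have [x0|x0] := leP x 0; first by rewrite rexp_le0// rexp_ge0.
have y0 := lt_le_trans x0 xy.
by rewrite /rexp x0 y0 !expr0 !mul1r ler_expR lerN2 lef_pV2.
Qed.

Lemma smooth_plateau : exists chi : R -> R, [/\ smooth chi,
  forall y, 0 <= chi y <= 1, forall y, `|y| <= 1 -> chi y = 1 &
  forall y, 2 <= `|y| -> chi y = 0].
Proof.
(* [rexp 0 (c - rexp 0 _)] is constant where the inner value vanishes and [0]
   where it reaches [c], so no quotient or integral is needed. *)
pose c := rexp 0 1.
have c0 : 0 < c by exact: rexp0_gt0.
have fc0 : 0 < rexp 0 c by exact: rexp0_gt0.
exists (fun y => (rexp 0 c)^-1 * rexp 0 (c - rexp 0 (y * y - 1))); split.
- move=> k; apply: (@Ck_mul _ _ _ (cst (rexp 0 c)^-1)); first exact: Ck_cst.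
  apply: (@Ck_comp _ _ _ (rexp 0)); first exact: smooth_rexp.
  apply: (@Ck_sub _ _ _ (cst c)); first exact: Ck_cst.
  apply: (@Ck_comp _ _ _ (rexp 0)); first exact: smooth_rexp.
  apply: (@Ck_sub R R k (fun y => y * y) (cst 1)); last exact: Ck_cst.
  by apply: (@Ck_mul R R k id id); exact: Ck_id.
- move=> y; rewrite mulr_ge0 ?rexp_ge0 ?invr_ge0 ?rexp_ge0//=.
  rewrite mulrC ler_pdivrMr// mul1r; apply: rexp0_nondecreasing.
  by rewrite gerBl rexp_ge0.
- move=> y y1; rewrite [X in c - X]rexp_le0 ?subr0 ?mulVf ?gt_eqF//.
  by rewrite -expr2 -real_normK ?num_real// subr_le0 expr_le1.
- move=> y y2; rewrite [X in _ * X]rexp_le0 ?mulr0// subr_le0.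
  apply: rexp0_nondecreasing; rewrite -expr2 -real_normK ?num_real//.
  by rewrite lerBrDr expr2; nra.
Qed.

(** The continuous function [|f'|] has a maximum on [[-a, a]]; outside, [f] is locally zero. *)
Lemma bounded_derivative_of_compact_support (f : R -> R) (a : R) : 0 < a ->
  Ck 1 f -> (forall y, a <= `|y| -> f y = 0) ->
  exists2 K : R, 0 < K & forall y, `|'D_1 f y| <= K.
Proof.
move=> a0 f1 fa.
have nc : continuous (fun y => `|'D_1 f y|).
  move=> y; apply: (@continuous_comp _ _ _ ('D_1 f) (@Num.norm R R)).
    exact: (Ck_continuous (Ck_derive (1 : R) f1)).
  exact: norm_continuous.
have aa : - a <= a by rewrite ge0_cp ?ltW.
have [c _ hc] := EVT_max aa (continuous_subspaceT nc).
exists (`|'D_1 f c| + 1); first by rewrite ltr_wpDl.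
move=> y; have [ya|ya] := leP `|y| a.
  rewrite ler_wpDr//; apply: hc.
  by rewrite in_itv/= -ler_norml.
suff -> : 'D_1 f y = 0 by rewrite normr0 addr_ge0.
have -> : 'D_1 f y = 'D_1 (cst 0 : R -> R) y.
  apply: near_eq_derive; near=> z; apply: fa.
  apply: ltW; near: z.
  exact: (@norm_continuous _ R y _ (lt_nbhsr ya)).
exact: derive_cst.
Unshelve. all: by end_near. Qed.

End Bump.

(** * Contractive perturbations of the identity on the line *)

Section PerturbedIdentity.
Variables (R : realType) (p : R -> R).
Hypothesis p_lip : forall x y, `|p x - p y| <= 2^-1 * `|x - y|.

(** The perturbation can absorb at most half of [|x - y|]. Injectivity and continuity of the inverse
    both come from this estimate. *)
Lemma perturbed_id_expand x y :
  `|x - y| <= 2 * `|(x + p x) - (y + p y)|.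
Proof.
have := p_lip x y; have : `|x - y| <= `|(x + p x) - (y + p y)| + `|p x - p y|.
  have {1}-> : x - y = ((x + p x) - (y + p y)) - (p x - p y) by ring.
  exact: ler_normB.
lra.
Qed.

Lemma lipschitz_half_continuous : continuous p.
Proof.
move=> x; apply/cvgrPdist_lt => e e0; near=> y.
apply: le_lt_trans (p_lip x y) _.
have xy : `|x - y| < e by near: y; exact: cvgr_dist_lt.
by have := normr_ge0 (x - y); lra.
Unshelve. all: by end_near. Qed.

Lemma perturbed_id_surj v : exists x, x + p x = v.
Proof.
(* Both [|p M|] and [|p (- M)|] are at most [|p 0| + M / 2], so [M + p M >= M / 2 - |p 0| = |v|],
   and symmetrically at [- M]. *)
pose M := 2 * (`|v| + `|p 0|).
have M0 : 0 <= M by rewrite mulr_ge0// addr_ge0.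
have lM := p_lip M 0; have lN := p_lip (- M) 0.
rewrite !subr0 normrN (ger0_norm M0) in lM lN.
have v1 := ler_norm v; have v2 := ler_norm (- v); rewrite normrN in v2.
have w1 := ler_norm (p 0); have w2 := ler_norm (- p 0); rewrite normrN in w2.
move: lM lN; rewrite !ler_norml => /andP[a1 a2] /andP[b1 b2].
have fc : continuous (fun x => x + p x).
  by move=> x; apply: cvgD; [exact: cvg_id|exact: lipschitz_half_continuous].
have MM : - M <= M by lra.
have f1 : - M + p (- M) <= v by rewrite /M in b2 *; lra.
have f2 : v <= M + p M by rewrite /M in a1 *; lra.
have [|x _ <-] :=
  @IVT R (fun x => x + p x) (- M) M v MM (continuous_subspaceT fc).
  by rewrite ge_min le_max f1 f2 orbT.
by exists x.
Qed.

Lemma perturbed_id_bij : exists g : R -> R,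
  cancel (fun x => x + p x) g /\ cancel g (fun x => x + p x).
Proof.
have /choice[g gK] := perturbed_id_surj.
exists g; split=> // x.
have := perturbed_id_expand (g (x + p x)) x.
rewrite gK subrr normr0 mulr0 normr_le0 subr_eq0.
by move/eqP.
Qed.

Lemma perturbed_id_inverse_continuous (g : R -> R) :
  cancel g (fun x => x + p x) -> continuous g.
Proof.
move=> gK x; apply/cvgrPdist_lt => e e0; near=> y.
apply: le_lt_trans (perturbed_id_expand _ _) _.
rewrite !gK -ltr_pdivlMl//.
by near: y; apply: cvgr_dist_lt => //; rewrite mulr_gt0// invr_gt0.
Unshelve. all: by end_near. Qed.

End PerturbedIdentity.

(** * Smooth inverses and vertical shears of the plane *)

Section PerturbedIdentitySmooth.
Variable R : realType.

(** The local form serves functions whose derivative is controlled only near a point; the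
    intermediate point of the mean value theorem stays within distance [d] of [c]. *)
Lemma mean_value_bound (p : R -> R) (K c d : R) : Ck 1 p ->
  (forall x, `|x - c| <= d -> `|'D_1 p x| <= K) ->
  forall x, `|x - c| <= d -> `|p x - p c| <= K * `|x - c|.
Proof.
move=> p1 pK x; have pd (z : R) : is_derive z 1 p ('D_1 p z).
  exact: (Ck_is_derive _ _ p1).
have pc a b := continuous_subspaceT (A := `[a, b]) (Ck_continuous p1).
have [cx|/ltW xc] := leP c x => xcd.
  have [y + ->] := @MVT_segment R p ('D_1 p) c x cx (fun z _ => pd z) (pc _ _).
  rewrite in_itv/= => /andP[cy yx]; rewrite normrM ler_wpM2r// pK//.
  by apply: le_trans xcd; rewrite !ger0_norm ?subr_ge0// lerB.
have [y + E] := @MVT_segment R p ('D_1 p) x c xc (fun z _ => pd z) (pc _ _).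
rewrite distrC E [`|x - c|]distrC.
rewrite in_itv/= => /andP[xy yc]; rewrite normrM ler_wpM2r// pK//.
apply: le_trans xcd; rewrite [leLHS]distrC [leRHS]distrC.
by rewrite !ger0_norm ?subr_ge0// lerB.
Qed.

Lemma lipschitz_of_derivative (p : R -> R) (K : R) : Ck 1 p ->
  (forall x, `|'D_1 p x| <= K) -> forall x y, `|p x - p y| <= K * `|x - y|.
Proof.
move=> p1 pK x y.
by apply: (@mean_value_bound p K y `|x - y|) => // z _; exact: pK.
Qed.

(** Bootstrapping on [g' = 1 / (1 + p' \o g)]: if [g] is C^j then so is [g'], and [g] is C^(j+1).
    Continuity of [g] starts the induction. *)
Lemma Ck_perturbed_id_inverse k (p g : R -> R) : Ck k.+1 p ->
  (forall x, `|'D_1 p x| <= 2^-1) ->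
  cancel (fun x => x + p x) g -> cancel g (fun x => x + p x) -> Ck k.+1 g.
Proof.
move=> pk dp fK gK.
have Ck1 j (q : R -> R) : Ck j.+1 q -> Ck 1 q.
  by elim: j => // j IH qj; apply: IH; exact: CkW.
have pl := lipschitz_of_derivative (Ck1 _ _ pk) dp.
have gc := perturbed_id_inverse_continuous pl gK.
have d0 x : 1 + 'D_1 p x != 0.
  by rewrite gt_eqF//; have := dp x; rewrite ler_norml => /andP[]; lra.
have gd (y : R) : is_derive y 1 g (1 + 'D_1 p (g y))^-1.
  rewrite -{1}(gK y).
  apply: (@is_derive_inverse R (fun x => x + p x) g) => //.
  - by near=> x; exact: fK.
  - near=> x; apply: cvgD; first exact: cvg_id.
    exact: (Ck_continuous pk).
  - apply: is_deriveD; exact: (Ck_is_derive _ _ pk).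
have dg j : Ck j.+1 p -> Ck j g -> Ck j (fun y => (1 + 'D_1 p (g y))^-1).
  move=> pj gj; apply: (@Ck_inv _ _ _ (fun y => 1 + 'D_1 p (g y))) => //.
  apply: (@Ck_add R R R j (cst 1) ('D_1 p \o g)); first exact: Ck_cst.
  by apply: Ck_comp => //; exact: Ck_derive.
elim: k pk => [|k IH] pk; apply: (derive1_Ck gd); apply: dg => //.
by apply: IH; exact: CkW.
Unshelve. all: by end_near. Qed.

(** On each vertical line the map is a perturbed identity, hence bijective; the real issue is the
    joint continuity of the inverse. *)
Lemma vertical_shear_homeomorphism (a b : R -> R) : continuous a ->
  (forall x z w, `|a x * b z - a x * b w| <= 2^-1 * `|z - w|) ->
  continuous b ->
  homeomorphism (fun q : R * R => (q.1, q.2 + a q.1 * b q.2)).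
Proof.
move=> ac abl bc.
have c1 : continuous (fst : R * R -> R) by move=> q; exact: cvg_fst.
have c2 : continuous (snd : R * R -> R) by move=> q; exact: cvg_snd.
have ac1 : continuous (a \o fst : R * R -> R) :=
  @Ck_comp _ (R * R)%type 0 a fst ac c1.
have bc2 : continuous (b \o snd : R * R -> R) :=
  @Ck_comp _ (R * R)%type 0 b snd bc c2.
split.
  apply: (@Ck_pair R (R * R)%type R R 0 fst) => //.
  exact: (@Ck_add _ _ _ 0 snd _ c2 (@Ck_mul _ _ 0 _ _ ac1 bc2)).
have /choice[g gK] : forall x, exists g : R -> R,
  cancel (fun z => z + a x * b z) g /\ cancel g (fun z => z + a x * b z).
  by move=> x; exact: (perturbed_id_bij (abl x)).
exists (fun q => (q.1, g q.1 q.2)); split; last first.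
  split=> -[x z] /=; first by rewrite (gK x).1.
  by rewrite (gK x).2.
apply: (@Ck_pair R (R * R)%type R R 0 fst) => // -[x0 y0].
pose z0 := g x0 y0.
(* Twice the residual of the fixed candidate [z0] for the target [q]. The expansion estimate on the
   line over [q.1] bounds [|g q.1 q.2 - z0|] by it, so continuity of [err] suffices. *)
pose err (q : R * R) := 2 * `|q.2 - (z0 + a q.1 * b z0)|.
have errc : continuous err.
  apply: (@Ck_mul R _ 0 (cst 2)); first exact: Ck_cst.
  apply: (@Ck_comp R _ 0 Num.norm); first exact: norm_continuous.
  apply: (@Ck_sub R (R * R)%type 0 snd); first exact: c2.
  apply: (@Ck_add R (R * R)%type R 0 (cst z0)); first exact: Ck_cst.
  by apply: (@Ck_mul R _ 0 _ (cst (b z0)) ac1); exact: Ck_cst.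
have err0 : err (x0, y0) = 0.
  by rewrite /err /= (gK x0).2 subrr normr0 mulr0.
apply/cvgrPdist_lt => e e0; near=> q.
have le : `|z0 - g q.1 q.2| <= err q.
  rewrite distrC; apply: le_trans (perturbed_id_expand (abl q.1) _ _) _.
  by rewrite (gK q.1).2.
apply: le_lt_trans le _; near: q.
have := errc (x0, y0); rewrite /continuous_at err0.
by move/cvgr_lt; apply.
Unshelve. all: by end_near. Qed.

End PerturbedIdentitySmooth.

(** * Straightening a piece of the curve *)

Section Flattening.
Variable R : realType.

Lemma smooth_affine (a b : R) : smooth (fun x : R => a * (x - b)).
Proof.
move=> k; apply: (@Ck_mul R R k (cst a)); first exact: Ck_cst.
by apply: (@Ck_sub R R k id (cst b)); [exact: Ck_id|exact: Ck_cst].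
Qed.

Lemma smooth_comp1 (f g : R -> R) : smooth f -> smooth g -> smooth (f \o g).
Proof. by move=> fk gk k; apply: Ck_comp. Qed.

(** A cutoff at scale [eta] has derivative of order [1 / eta], but [e] is at most [2 kap eta] on its
    support because [e s0 = 0] and [|e'| <= kap] there; the product stays small. *)
Lemma cutoff_small_derivative (e : R -> R) (s0 : R) :
  smooth e -> e s0 = 0 -> 'D_1 e s0 = 0 ->
  exists p : R -> R, [/\ smooth p, forall s, `|'D_1 p s| <= 2^-1 &
    \forall s \near s0, p s = e s].
Proof.
move=> es es0 des0.
have [chi [chis chi01 chi1 chi0]] := smooth_plateau R.
have [K K0 dK] :=
  bounded_derivative_of_compact_support (ltr0Sn R 1) (chis 1) chi0.
(* The product rule will give the bound [kap + 2 kap K], which for this [kap] is exactly [1/2]. *)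
pose kap := (2 * (2 * K + 1))^-1.
have kap0 : 0 < kap by rewrite invr_gt0 mulr_gt0// ltr_wpDl// mulr_ge0 ?ltW.
have dec : continuous ('D_1 e).
  exact: (Ck_continuous (Ck_derive (1 : R) (es 1))).
have : \forall s \near s0, `|'D_1 e s| < kap.
  have /cvgrPdist_lt/(_ _ kap0) := dec s0.
  by rewrite des0; apply: filterS => s; rewrite sub0r normrN.
move=> /nbhs_ballP[d /= d0 hd].
pose eta := d / 4.
have eta0 : 0 < eta by rewrite divr_gt0.
have de s : `|s - s0| <= 2 * eta -> `|'D_1 e s| <= kap.
  move=> ss; apply/ltW/hd; rewrite /ball/= distrC; apply: le_lt_trans ss _.
  by rewrite /eta; lra.
have be s : `|s - s0| <= 2 * eta -> `|e s| <= kap * (2 * eta).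
  move=> ss; have := mean_value_bound (es 1) de ss.
  by rewrite es0 subr0 => /le_trans; apply; rewrite ler_wpM2l// ltW.
pose A (s : R) := eta^-1 * (s - s0).
have As : smooth A by exact: smooth_affine.
have nA s : `|A s| = eta^-1 * `|s - s0|.
  by rewrite normrM gtr0_norm// invr_gt0.
have cAs : smooth (chi \o A) by exact: smooth_comp1.
have ps : smooth ((chi \o A) * e) by move=> k; apply: Ck_mul.
exists ((chi \o A) * e); split => //.
- move=> s; have [ss|ss] := leP `|s - s0| (2 * eta).
  + have dA : is_derive s 1 A eta^-1.
      have := is_deriveM (is_derive_cst eta^-1 s 1)
        (is_deriveB (is_derive_id s (1:R)) (is_derive_cst s0 s 1)).
      move=> H; apply: (is_derive_eq H).
      by rewrite /= /GRing.scale/= subr0 mulr0 addr0 mulr1.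
    have dc : is_derive (A s) 1 chi ('D_1 chi (A s)).
      exact: (Ck_is_derive _ _ (chis 1)).
    have := is_deriveM (is_derive_comp dc dA) (Ck_is_derive s 1 (es 1)).
    move=> /@derive_val ->; rewrite /GRing.scale/=.
    apply: le_trans (ler_normD _ _) _; rewrite !normrM.
    have [c0 c1] := andP (chi01 (A s)); rewrite (ger0_norm c0).
    have eV : `|eta^-1| = eta^-1 by rewrite gtr0_norm// invr_gt0.
    rewrite eV.
    have t1 : chi (A s) * `|'D_1 e s| <= kap.
      by apply: le_trans (de s ss); rewrite ler_piMl.
    have t2 : `|e s| * (eta^-1 * `|'D_1 chi (A s)|) <=
        kap * (2 * eta) * (eta^-1 * K).
      rewrite ler_pM ?be//; first by rewrite mulr_ge0// invr_ge0 ltW.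
      by rewrite ler_wpM2l ?invr_ge0 ?dK// ltW.
    apply: le_trans (lerD t1 t2) _.
    rewrite le_eqVlt; apply/orP; left; apply/eqP.
    rewrite /kap; field; rewrite (gt_eqF eta0)/=.
    by rewrite gt_eqF// ltr_wpDl// mulr_ge0 ?ltW.
  + suff -> : 'D_1 ((chi \o A) * e) s = 0 by rewrite normr0 invr_ge0.
    have -> : 'D_1 ((chi \o A) * e) s = 'D_1 (cst 0 : R -> R) s.
      apply: near_eq_derive.
      have : \forall z \near s, 2 * eta < `|z - s0|.
        have nc : (fun z : R => `|z - s0|) @ s --> `|s - s0|.
          by apply: cvg_norm; apply: cvgB; [exact: cvg_id|exact: cvg_cst].
        exact: (cvgr_gt _ nc).
      apply: filterS => z zz; rewrite -[LHS]/(chi (A z) * e z) chi0 ?mul0r//.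
      by rewrite nA ler_pdivlMl// mulrC ltW.
    exact: derive_cst.
- near=> s; rewrite -[LHS]/(chi (A s) * e s) chi1 ?mul1r//.
  rewrite nA ler_pdivrMl// mulr1 distrC; apply: ltW; near: s.
  exact: nbhsx_ballx.
Unshelve. all: by end_near. Qed.

(** An inverse function theorem made global: an affine rescaling of [r] is [s - s0] plus an error
    [e] that vanishes with its derivative at [s0]. Cutting off [e] gives a diffeomorphism of the
    whole line, so [g] is defined everywhere. *)
Lemma local_graph (r h : R -> R) (s0 : R) : smooth r -> smooth h ->
  'D_1 r s0 != 0 ->
  exists g : R -> R, smooth g /\ \forall s \near s0, g (r s) = h s.
Proof.
move=> rs hs; set c := 'D_1 r s0 => c0.
pose e : R -> R := (fun s => c^-1 * (r s - r s0)) - (fun s => 1 * (s - s0)).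
have crs : smooth (fun s => c^-1 * (r s - r s0)).
  exact: (smooth_comp1 (@smooth_affine c^-1 (r s0)) rs).
have es : smooth e by move=> k; apply: Ck_sub => //; exact: smooth_affine.
have es0 : e s0 = 0 by rewrite -[LHS]/(_ * _ - _ * _) !subrr !mulr0 subrr.
have de : 'D_1 e s0 = 0.
  have d1 : is_derive s0 1 (fun s => c^-1 * (r s - r s0)) 1.
    have := is_deriveM (is_derive_cst c^-1 s0 1)
      (is_deriveB (Ck_is_derive s0 1 (rs 1)) (is_derive_cst (r s0) s0 1)).
    move=> H; apply: (is_derive_eq H).
    by rewrite /= /GRing.scale/= subr0 mulr0 addr0 mulVf.
  have d2 : is_derive s0 1 (fun s : R => 1 * (s - s0)) 1.
    have := is_deriveM (is_derive_cst (1:R) s0 1)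
      (is_deriveB (is_derive_id s0 (1:R)) (is_derive_cst s0 s0 1)).
    move=> H; apply: (is_derive_eq H).
    by rewrite /= /GRing.scale/= subr0 mulr0 addr0 mulr1.
  by have /@derive_val -> := is_deriveB d1 d2; rewrite subrr.
have [p [ps dp pe]] := cutoff_small_derivative es es0 de.
have pl := lipschitz_of_derivative (ps 1) dp.
have [u [fu uf]] := perturbed_id_bij pl.
have us : smooth u.
  by move=> k; apply: CkW; apply: Ck_perturbed_id_inverse fu uf.
(* Chosen so that [B (r s) = s + e s], which is [s + p s] near [s0]; then [u] recovers [s]. *)
pose B (x : R) := c^-1 * (x - (r s0 - c * s0)).
exists (h \o (u \o B)); split.
  by apply: smooth_comp1 => //; apply: smooth_comp1 => //; exact: smooth_affine.
apply: filterS pe => s pse; rewrite /=; congr h.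
rewrite -[RHS]fu pse; congr u; rewrite /B -[e s]/(_ * _ - _ * _); field.
exact: c0.
Qed.

(** Only values, not derivatives, have to be small here, so continuity and [f x0 = 0] suffice once
    the cutoff is narrow. *)
Lemma small_cutoff (f : R -> R) (x0 kap eps : R) : smooth f -> f x0 = 0 ->
  0 < kap -> 0 < eps ->
  exists G : R -> R, [/\ smooth G, forall x, `|G x| <= kap,
    forall x, eps <= `|x - x0| -> G x = 0 & \forall x \near x0, G x = f x].
Proof.
move=> fs fx0 kap0 eps0.
have [chi [chis chi01 chi1 chi0]] := smooth_plateau R.
have : \forall x \near x0, `|f x| < kap.
  have fc : continuous f by exact: (Ck_continuous (fs 0)).
  have /cvgrPdist_lt/(_ _ kap0) := fc x0.
  by rewrite fx0; apply: filterS => s; rewrite sub0r normrN.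
move=> /nbhs_ballP[d /= d0 hd].
(* The cutoff vanishes from distance [2 eta] on, the smaller of [eps] and the radius [d] within
   which [|f| < kap]. *)
pose eta := Num.min d eps / 2.
have eta0 : 0 < eta by rewrite divr_gt0// lt_min d0.
pose A (s : R) := eta^-1 * (s - x0).
have As : smooth A by exact: smooth_affine.
have nA s : `|A s| = eta^-1 * `|s - x0|.
  by rewrite normrM gtr0_norm// invr_gt0.
have cA0 s : eta * 2 <= `|s - x0| -> chi (A s) = 0.
  by move=> ss; rewrite chi0// nA ler_pdivlMl.
have eta2 : eta * 2 = Num.min d eps by rewrite /eta; field.
exists ((chi \o A) * f); split.
- by move=> k; apply: Ck_mul => //; exact: smooth_comp1.
- move=> x; rewrite -[X in `|X|]/(chi (A x) * f x) normrM.
  have [c0 c1] := andP (chi01 (A x)); rewrite (ger0_norm c0).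
  have [xx|xx] := leP (eta * 2) `|x - x0|; first by rewrite cA0// mul0r ltW.
  apply: (@le_trans _ _ `|f x|); first by rewrite ler_piMl.
  apply/ltW/hd; rewrite /ball/= distrC; apply: lt_le_trans xx _.
  by rewrite eta2 ge_min lexx.
- move=> x xx; rewrite -[LHS]/(chi (A x) * f x) cA0 ?mul0r//.
  by apply: le_trans xx; rewrite eta2 ge_min lexx orbT.
- near=> s; rewrite -[LHS]/(chi (A s) * f s) chi1 ?mul1r//.
  rewrite nA ler_pdivrMl// mulr1 distrC; apply: ltW; near: s.
  exact: nbhsx_ballx.
Unshelve. all: by end_near. Qed.

Lemma flattening_isotopy (g : R -> R) (x0 eps : R) : smooth g -> 0 < eps ->
  exists al : R -> R * R -> R * R, [/\ isotopy al,
    forall t q, (al t q).1 = q.1,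
    forall t q, al t q <> q -> `|q.1 - x0| < eps /\ `|q.2 - g x0| < eps &
    \forall q \near (x0, g x0), q.2 = g q.1 -> (al 1 q).2 = g x0].
Proof.
move=> gs eps0; set z0 := g x0.
have [chi [chis chi01 chi1 chi0]] := smooth_plateau R.
have [K K0 dK] :=
  bounded_derivative_of_compact_support (ltr0Sn R 1) (chis 1) chi0.
have chil := lipschitz_of_derivative (chis 1) dK.
(* The bump at scale [eps / 2] is [2 K / eps]-Lipschitz, so [|G| <= kap] makes the shear term
   [1/2]-Lipschitz on vertical lines. *)
pose kap := eps / (4 * K).
have kap0 : 0 < kap by rewrite divr_gt0// mulr_gt0.
have fs : smooth (cst z0 - g) by move=> k; apply: Ck_sub => //; exact: Ck_cst.
have fx0 : (cst z0 - g) x0 = 0 by rewrite -[LHS]/(z0 - z0) subrr.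
have [G [Gs Gk G0 Gf]] := small_cutoff fs fx0 kap0 eps0.
pose A (z : R) := (eps / 2)^-1 * (z - z0).
have As : smooth A by exact: smooth_affine.
have e2 : 0 < eps / 2 by rewrite divr_gt0.
have nA s : `|A s| = (eps / 2)^-1 * `|s - z0|.
  by rewrite normrM gtr0_norm// invr_gt0.
have bs : smooth (chi \o A) by exact: smooth_comp1.
exists (fun t q => (q.1, q.2 + (t * G q.1) * (chi \o A) q.2)).
split; [idtac|by []|idtac|idtac].
- split; last split.
  + move: 3%N => k.
    have p0 : Ck k (fun q : R * (R * R) => q.1) by apply/Ck_fst/Ck_id.
    have p1 : Ck k (fun q : R * (R * R) => q.2.1).
      by apply/Ck_fst/Ck_snd/Ck_id.
    have p2 : Ck k (fun q : R * (R * R) => q.2.2).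
      by apply/Ck_snd/Ck_snd/Ck_id.
    have tG := Ck_mul p0 (Ck_comp (Gs k) p1).
    exact: (Ck_pair p1 (Ck_add p2 (Ck_mul tG (Ck_comp (bs k) p2)))).
  + move=> t /andP[t0 t1].
    apply: (@vertical_shear_homeomorphism R (fun x => t * G x)).
    * by apply: (@Ck_mul R R 0 (cst t)); [exact: Ck_cst|exact: Gs].
    * move=> x z w; rewrite -mulrBr normrM.
      have h1 : `|t * G x| <= kap.
        rewrite normrM ger0_norm//; apply: le_trans (Gk x).
        by rewrite ler_piMl.
      have h2 : `|(chi \o A) z - (chi \o A) w| <= K * ((eps / 2)^-1 * `|z - w|).
        apply: le_trans (chil _ _) _; rewrite ler_pM2l// /A -mulrBr normrM.
        rewrite gtr0_norm ?invr_gt0// ler_pM2l ?invr_gt0//.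
        by rewrite opprB addrA subrK.
      apply: le_trans (ler_pM _ _ h1 h2) _ => //.
      rewrite le_eqVlt; apply/orP; left; apply/eqP; rewrite /kap; field.
      by rewrite !gt_eqF.
    * exact: (Ck_continuous (bs 0)).
  + by move=> [x z] /=; rewrite !mul0r addr0.
- move=> t [x z] /= neq; split; rewrite ltNge; apply/negP => far; apply: neq.
    by rewrite G0// mulr0 mul0r addr0.
  rewrite chi0 ?mulr0 ?addr0// nA ler_pdivlMl//.
  by apply: le_trans far; rewrite mulrC; lra.
(* Near the base point [G x = z0 - g x] and the bump is 1, so at time 1 the height [g x] is moved to
   [z0]. *)
- near=> q => qg /=; rewrite mul1r.
  have -> : G q.1 = z0 - g q.1.
    near: q; exact: (@cvg_fst _ _ (nbhs x0) (nbhs z0) _ _ Gf).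
  rewrite chi1 ?mulr1 -?qg; first by rewrite addrC subrK.
  rewrite nA ler_pdivrMl// mulr1 distrC; apply: ltW; near: q.
  apply: (@cvg_snd _ _ (nbhs x0) (nbhs z0) _ (ball z0 (eps/2))).
  exact: nbhsx_ballx.
Unshelve. all: by end_near. Qed.

End Flattening.

(** * Deforming a surface of revolution that has a flat arc *)

Section FlatArc.
Variable R : realType.

(** Joint induction, as each function is up to sign the derivative of the other. *)
Lemma smooth_trig k : Ck k (@cos R) /\ Ck k (@sin R).
Proof.
elim: k => [|k [IHc IHs]].
  by split; [exact: continuous_cos|exact: continuous_sin].
split; last exact: (derive1_Ck (@is_derive_sin R)).
apply: (@derive1_Ck _ _ _ (- @sin R)); last exact: Ck_opp.
Qed.

Lemma periodic_int (T : Type) (f : R -> T) (c : R) :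
  (forall s, f (s + c) = f s) -> forall (k : int) s, f (s + k%:~R * c) = f s.
Proof.
move=> fc.
have nat_case (n : nat) s : f (s + n%:R * c) = f s.
  elim: n s => [|n IH] s; first by rewrite mul0r addr0.
  by rewrite -natr1 mulrDl mul1r addrA fc IH.
move=> [n|n] s; first exact: nat_case.
by rewrite -(nat_case n.+1 (s + _)) NegzE mulrNz mulNr subrK.
Qed.

(** Subtracting the nearest multiple of [2 pi] brings [y] into [[-pi, pi]], where the cosine
    decreases with the absolute value. *)
Lemma cos_gt_near_2pi (eta y : R) : 0 < eta < pi -> cos eta < cos y ->
  exists k : int, `|y - k%:~R * (2 * pi)| < eta.
Proof.
move=> /andP[eta0 etapi] cy.
have pi2 : 0 < 2 * pi :> R by rewrite mulr_gt0// pi_gt0.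
(* Adding one half before taking the floor rounds to the nearest integer. *)
pose k := Num.floor (y / (2 * pi) + 2^-1).
exists k; rewrite ltNge; apply/negP => le.
have k1 : k%:~R <= y / (2 * pi) + 2^-1 by exact: floor_le_tmp.
have k2 : y / (2 * pi) + 2^-1 < k%:~R + 1.
  by have := floorD1_gt (y / (2 * pi) + 2^-1); rewrite intrD.
set w := y - k%:~R * (2 * pi) in le *.
have wpi : `|w| <= pi.
  have e : y = y / (2 * pi) * (2 * pi) by rewrite divfK// gt_eqF.
  have pp := pi_gt0 R.
  by rewrite ler_norml /w {1 2}e; apply/andP; split; nra.
have cw : cos `|w| = cos y.
  rewrite cos_norm /w -mulNr -mulrNz.
  apply: (@periodic_int _ cos (2 * pi)) => s.
  by rewrite mulr_natl cosD2pi.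
move: cy; rewrite -cw ltr_cos ?in_itv/= ?(ltW eta0) ?(ltW etapi) ?normr_ge0//.
by rewrite ltNge le.
Qed.

(** Smoothness is asked of the radius: the height is constant on the arc where the field lives, and
    the profile will come from an isotopy of class C^3. *)
Lemma flat_arc_deformation (mu : R -> R * R) (s0 z0 : R) :
  smooth (fun s => (mu s).1) -> periodic2pi mu ->
  (\forall s \near s0, (mu s).2 = z0) ->
  exists Z : R * R -> R * R * R,
    inf_deformation (surf_rev mu) Z /\ ~ trivial_deformation (surf_rev mu) Z.
Proof.
move=> rs mup /nbhs_ballP[d /= d0 flat_near].
have [chi [chis _ chi1 chi0]] := smooth_plateau R.
have pp := pi_gt0 R.
(* At most 1, hence below [pi], in the range where the cosine is strictly decreasing. *)
pose eta := Num.min d 1.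
have eta0 : 0 < eta by rewrite lt_min d0 ltr01.
have etad : eta <= d by rewrite ge_min lexx.
have etapi : eta < pi.
  have : eta <= 1 by rewrite ge_min lexx orbT.
  by have := @pi_ge2 R; lra.
have ceta : cos eta < 1.
  by rewrite -cos0 ltr_cos// in_itv/= ?lexx ?ltW.
pose M := 4 / (1 - cos eta).
have M0 : 0 < M by rewrite divr_gt0// subr_gt0.
have ME : M * (1 - cos eta) = 4 by rewrite divfK// gt_eqF// subr_gt0.
(* Using [1 - cos] makes the bump periodic by construction. By the choice of [M], [A s <= 2] forces
   [cos (s - s0) > cos eta], so [s] is within [eta] of [s0] modulo [2 pi]. *)
pose A (s : R) := M * (1 - cos (s - s0)).
pose phi := chi \o A.
have As : smooth A.
  move=> k; apply: (@Ck_mul R R k (cst M)); first exact: Ck_cst.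
  apply: (@Ck_sub R R k (cst 1)); first exact: Ck_cst.
  apply: (@Ck_comp R R k cos); first exact: (smooth_trig k).1.
  by apply: (@Ck_sub R R k id (cst s0)); [exact: Ck_id|exact: Ck_cst].
have phis : smooth phi by exact: smooth_comp1.
have phip s : phi (s + 2 * pi) = phi s.
  by rewrite /phi /A /= addrAC mulr_natl cosD2pi.
have phiZ k : Ck k (fun p : R * R => phi p.1).
  by apply: (@Ck_comp R _ k phi) => //; apply/Ck_fst/Ck_id.
exists (fun p => (0, 0, phi p.1)); split; last first.
  move=> [m [om ZE]].
  (* The points at angles 0 and [pi] are opposite on their parallel, so averaging cancels the
     rotation term in the third coordinate: a trivial field would make [phi] constant. *)
  have phiE s : phi s = om.2.
    have := congr1 snd (ZE (s, 0)); have := congr1 snd (ZE (s, pi)).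
    rewrite /surf_rev /= sinpi cospi sin0 cos0.
    by set a := m.1.1; set b := m.1.2; lra.
  have p0 : phi s0 = 1.
    by rewrite /phi /A /= subrr cos0 subrr mulr0 chi1// normr0.
  (* Here [A (s0 + pi) = 2 M], which is at least 4 because [1 - cos eta <= 2]. *)
  have p1 : phi (s0 + pi) = 0.
    rewrite /phi /A /= [s0 + pi]addrC addrK cospi chi0//.
    rewrite ger0_norm; last by rewrite mulr_ge0 ?ltW//; lra.
    by have := cos_geN1 eta; nra.
  by move: p1; rewrite phiE -(phiE s0) p0 => /eqP; rewrite oner_eq0.
split; last split; last split.
- move=> k; apply: Ck_pair; last exact: phiZ.
  exact: (Ck_cst _ _ (0, 0)).
- by move=> s t; rewrite /= phip.
- by [].
- move=> p X.
  have dZ : is_derive p X (fun p => (0, 0, phi p.1) : R * R * R)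
      (0, 0, 'D_X (fun p : R * R => phi p.1) p).
    exact: (@is_derive_pair R (R * R)%type (R * R)%type R (cst (0, 0)) _ p X
      (0, 0) _ (is_derive_cst _ _ _) (Ck_is_derive _ _ (phiZ 1))).
  have Ac : continuous A by exact: (Ck_continuous (As 0)).
  (* Where [A] exceeds 2 the bump vanishes on a neighbourhood and [dZ = 0]; otherwise the curve is
     flat near [p.1], and [dF] is horizontal while [dZ] is vertical. *)
  have [A3|A3] := ltP 2 (A p.1).
    rewrite (@derive_val _ _ _ _ _ _ _ dZ).
    have -> : 'D_X (fun p : R * R => phi p.1) p = 'D_X (cst 0 : R * R -> R) p.
      apply: near_eq_derive.
      have : \forall s \near p.1, 2 < A s by exact: (cvgr_gt _ (Ac p.1)).
      move=> Anear; near=> q; have Aq : 2 < A q.1.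
        by near: q; exact: (@cvg_fst _ _ (nbhs p.1) (nbhs p.2) _ _ Anear).
      by rewrite /phi /= chi0// ltW//; exact: lt_le_trans Aq (ler_norm _).
    by rewrite derive_cst /dot3 /= !mul0r !addr0.
  have [||k hk] := @cos_gt_near_2pi eta (p.1 - s0).
  - by rewrite eta0.
  - by move: A3; rewrite /A; nra.
  have dF : is_derive p X (surf_rev mu)
     ('D_X (fun q : R * R => (mu q.1).1 * cos q.2) p,
      'D_X (fun q : R * R => (mu q.1).1 * sin q.2) p, 0).
    apply: (@near_eq_is_derive _ _ _ (fun q : R * R =>
       ((mu q.1).1 * cos q.2, (mu q.1).1 * sin q.2, z0))).
      have : \forall s \near p.1, `|s - s0 - k%:~R * (2 * pi)| < eta.
        have nc : (fun s : R => `|s - s0 - k%:~R * (2 * pi)|) @ p.1 -->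
            `|p.1 - s0 - k%:~R * (2 * pi)|.
          apply: cvg_norm; apply: cvgB; last exact: cvg_cst.
          by apply: cvgB; [exact: cvg_id|exact: cvg_cst].
        exact: (cvgr_lt _ nc).
      move=> knear; near=> q.
      have qk : `|q.1 - s0 - k%:~R * (2 * pi)| < eta.
        by near: q; exact: (@cvg_fst _ _ (nbhs p.1) (nbhs p.2) _ _ knear).
      rewrite /surf_rev; congr (_, _).
      rewrite -[q.1](subrK (k%:~R * (2 * pi))) periodic_int// flat_near//.
      rewrite /ball/= distrC addrAC; exact: lt_le_trans qk etad.
    have r1 : Ck 1 (fun q : R * R => (mu q.1).1).
      by apply: (Ck_comp (rs 1)); apply/Ck_fst/Ck_id.
    have c1 : Ck 1 (fun q : R * R => cos q.2).
      by apply: (Ck_comp (smooth_trig 1).1); apply/Ck_snd/Ck_id.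
    have n1 : Ck 1 (fun q : R * R => sin q.2).
      by apply: (Ck_comp (smooth_trig 1).2); apply/Ck_snd/Ck_id.
    have d12 := is_derive_pair (Ck_is_derive p X (Ck_mul r1 c1))
      (Ck_is_derive p X (Ck_mul r1 n1)).
    exact: (is_derive_pair d12 (is_derive_cst z0 p X)).
  rewrite (@derive_val _ _ _ _ _ _ _ dZ) (@derive_val _ _ _ _ _ _ _ dF).
  by rewrite /dot3 /= !mul0r mulr0 !addr0.
Unshelve. all: by end_near. Qed.

End FlatArc.

(** * Assembling the shear and the vertical field on the given curve *)

Theorem mainTheorem1 (R : realType) (lam : R -> R * R) :
  smooth_embedding_S1 lam ->
  (forall s, 0 < (lam s).1) ->
  forall B : set (R * R), compact B -> range lam `<=` B° ->
  exists al : R -> R * R -> R * R,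
    isotopy al /\ admissible (range lam) al /\ isotopy_support al `<=` B /\
    exists Z : R * R -> R * R * R,
      inf_deformation (surf_rev (al 1 \o lam)) Z /\
      ~ trivial_deformation (surf_rev (al 1 \o lam)) Z.
Proof.
move=> [lams [lamp [_ dlam]]] lam0 B Bc lamB.
have rs : smooth (fun s => (lam s).1) by move=> k; exact: Ck_fst.
have hs : smooth (fun s => (lam s).2) by move=> k; exact: Ck_snd.
have [s0 r0] : exists s0, 'D_1 (fun s => (lam s).1) s0 != 0.
  have pi2 : 0 < 2 * pi :> R by rewrite mulr_gt0// pi_gt0.
  have [|||s0 _ h0] := @Rolle R (fun s => (lam s).2) 0 (2 * pi) pi2.
  - by move=> x _; have [] := Ck_is_derive x 1 (hs 1).
  - exact: continuous_subspaceT (Ck_continuous (hs 0)).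
  - by rewrite -[in RHS](add0r (2 * pi)) lamp.
  exists s0; apply/eqP => r0; apply: (dlam s0).
  have dr := Ck_is_derive s0 1 (rs 1); rewrite r0 in dr.
  have -> : lam = fun s => ((lam s).1, (lam s).2).
    by apply/funext => s; case: (lam s).
  exact: (@derive_val _ _ _ _ _ _ _ (is_derive_pair dr h0)).
have [g [gs gh]] := local_graph rs hs r0.
have gs0 : g (lam s0).1 = (lam s0).2 by exact: nbhs_singleton gh.
have /nbhs_ballP[eps /= eps0 epsB] : nbhs (lam s0) B by apply: lamB; exists s0.
have [al [ali al1 al2 al3]] := flattening_isotopy (lam s0).1 gs eps0.
rewrite gs0 in al2 al3.
exists al; split=> //; split; [|split].
- by move=> t _ _ [s _ <-]; rewrite al1.
(* Balls of the product norm are squares, so the two coordinate bounds put every moved point in [B],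
   and closedness of [B] takes care of the closure. *)
- have Bcl : closed B by exact: compact_closed (@norm_hausdorff _ _) Bc.
  rewrite /isotopy_support; apply: subset_trans (_ : closure B `<=` _).
    apply: closure_subset => q [t [_ /al2[q1 q2]]]; apply: epsB.
    by split; rewrite /ball/= distrC.
  by rewrite -(closure_id B).1.
- apply: (@flat_arc_deformation R _ s0 (lam s0).2).
  + have -> : (fun s => ((al 1 \o lam) s).1) = fun s => (lam s).1.
      by apply/funext => s; exact: al1.
    exact: rs.
  + by move=> s; rewrite /= lamp.
  + have lamc : continuous lam by exact: (Ck_continuous (lams 0)).
    (* Flattening holds near [lam s0] in the plane; continuity of [lam] pulls it back to parameters
       near [s0]. *)
    move: al3; rewrite -surjective_pairing => /(lamc s0) al3.
    near=> s.
    have gls : g (lam s).1 = (lam s).2 by near: s.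
    have flats : (lam s).2 = g (lam s).1 -> (al 1 (lam s)).2 = (lam s0).2.
      by near: s; exact: al3.
    exact: flats.
Unshelve. all: by end_near. Qed.
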